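(* The variety of semilattices satisfies TImC.
   Context: A semilattice is an algebra with a single binary operation that is associative, commutative and idempotent. A tolerance of an algebra $\mathbf A=(A;F)$ is a reflexive, symmetric relation $\tau\subseteq A^2$ compatible with all operations in $F$. If $\phi\colon\mathbf B\to\mathbf A$ is a homomorphism and $\vartheta\subseteq B^2$, write $\phi(\vartheta)=\{(\phi(a),\phi(b)):(a,b)\in\vartheta\}$. A variety $\mathcal V$ satisfies TImC (its tolerances are homomorphic images of its congruences) if for every $\mathbf A\in\mathcal V$ and every tolerance $\tau$ of $\mathbf A$ there exist an algebra $\mathbf B\in\mathcal V$, a congruence $\vartheta$ of $\mathbf B$, and a homomorphism $\phi\colon\mathbf B\to\mathbf A$ such that $\tau=\phi(\vartheta)$. *)

(* Defs.v *)
From Stdlib Require Import RelationClasses.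
From mathcomp Require Import all_boot.

Set Implicit Arguments.
Unset Strict Implicit.
Unset Printing Implicit Defensive.

Record signature := Signature {
  symbol : Type;
  arity : symbol -> nat
}.

(* Operations act on tuples rather than on functions 'I_n -> carrier, so that
   equality of argument lists is pointwise without functional extensionality.
   Empty carriers are allowed. In TImC this is harmless: for A empty one can
   take B = A, and for A nonempty reflexivity of tau forces B to be nonempty. *)
Record algebra (S : signature) := Algebra {
  carrier :> Type;
  interp : forall f : symbol S, (arity f).-tuple carrier -> carrier
}.

Section UniversalAlgebra.
Context {S : signature}.

Inductive term : Type :=
| Var of nat
| App (f : symbol S) of ('I_(arity f) -> term).

Fixpoint eval (A : algebra S) (v : nat -> A) (t : term) : A :=
  match t with
  | Var n => v n
  | App f args => interp [tuple eval v (args i) | i < arity f]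
  end.

Definition satisfies (A : algebra S) (e : term * term) : Prop :=
  forall v : nat -> A, eval v e.1 = eval v e.2.

(* The variety defined by a set E of identities, as the class of its models. *)
Definition variety (E : term * term -> Prop) (A : algebra S) : Prop :=
  forall e, E e -> satisfies A e.

Definition homomorphism (B A : algebra S) (phi : B -> A) : Prop :=
  forall (f : symbol S) (b : (arity f).-tuple B),
    phi (interp b) = interp (map_tuple phi b).

Definition compatible (A : algebra S) (r : A -> A -> Prop) : Prop :=
  forall (f : symbol S) (a b : (arity f).-tuple A),
    (forall i, r (tnth a i) (tnth b i)) -> r (interp a) (interp b).

Definition tolerance (A : algebra S) (r : A -> A -> Prop) : Prop :=
  [/\ Reflexive r, Symmetric r & compatible r].

Definition congruence (A : algebra S) (r : A -> A -> Prop) : Prop :=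
  Equivalence r /\ compatible r.

Definition rel_image (B A : Type) (phi : B -> A) (r : B -> B -> Prop)
    (x y : A) : Prop :=
  exists a b : B, [/\ r a b, x = phi a & y = phi b].

Definition TImC (V : algebra S -> Prop) : Prop :=
  forall A : algebra S, V A ->
  forall tau : A -> A -> Prop, tolerance tau ->
  exists (B : algebra S) (theta : B -> B -> Prop) (phi : B -> A),
    [/\ V B, congruence theta, homomorphism phi
      & forall x y : A, tau x y <-> rel_image phi theta x y].

End UniversalAlgebra.

Arguments term : clear implicits.

Definition binary_signature : signature :=
  @Signature unit (fun=> 2).

Definition mul_term (s t : term binary_signature) : term binary_signature :=
  @App binary_signature tt (tnth [tuple s; t]).

Inductive semilattice_identity :
    term binary_signature * term binary_signature -> Prop :=
| semilattice_assoc : semilattice_identity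
    (mul_term (Var 0) (mul_term (Var 1) (Var 2)),
     mul_term (mul_term (Var 0) (Var 1)) (Var 2))
| semilattice_comm : semilattice_identity
    (mul_term (Var 0) (Var 1), mul_term (Var 1) (Var 0))
| semilattice_idem : semilattice_identity
    (mul_term (Var 0) (Var 0), Var 0).

Definition semilattices : algebra binary_signature -> Prop :=
  variety semilattice_identity.

Definition mul (A : algebra binary_signature) (x y : A) : A :=
  @interp binary_signature A tt [tuple x; y].

Lemma eval_mul_term (A : algebra binary_signature) (v : nat -> A) s t :
  eval v (mul_term s t) = mul (eval v s) (eval v t).
Proof.
rewrite /mul /=; congr (interp _); apply: eq_from_tnth => i.
by rewrite tnth_mktuple; case: i => [[|[|]]] //= ?; rewrite !(tnth_nth (Var 0), tnth_nth (v 0)).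
Qed.

Lemma semilatticesP (A : algebra binary_signature) :
  semilattices A <->
  [/\ associative (@mul A), commutative (@mul A) & idempotent_op (@mul A)].
Proof.
split=> [HA | [mulA mulC mulxx] _ [] v]; last first.
- by rewrite !eval_mul_term mulxx.
- by rewrite !eval_mul_term mulC.
- by rewrite !eval_mul_term mulA.
pose v (x y z : A) n := nth z [:: x; y] n.
split=> [x y z | x y | x].
- by have := HA _ semilattice_assoc (v x y z); rewrite !eval_mul_term.
- by have := HA _ semilattice_comm (v x y y); rewrite !eval_mul_term.
- by have := HA _ semilattice_idem (v x x x); rewrite !eval_mul_term.
Qed.

(* Main.v *)
From mathcomp Require Import all_boot.
From mathcomp Require Import boolp classical_sets.
Require Import Defs.

Set Implicit Arguments.
Unset Strict Implicit.
Unset Printing Implicit Defensive.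

Local Open Scope classical_set_scope.

(** Let [tau] be a tolerance of a semilattice [A].  A congruence is obtained
by making the reason for two elements being related part of the elements: let
[B] consist of the pairs [(C, a)] where [a] belongs to [C] and [C] is a
subsemilattice of [A] any two members of which are [tau]-related.  Such sets
[C] are multiplied elementwise, and [B] is a subalgebra of the product of the
algebra of these sets with [A].  Having the same first component is then a
congruence of [B], being the kernel of a projection, and the other projection
maps it into [tau], because [a] and [b] are related as soon as they lie in a
common [C].

Two points need an argument.  The elementwise product is associative and
commutative on all subsets of [A], but idempotent only on subsemilattices; this
is why [C] is required to be one ([set_mulxx]), and the requirement is
preserved by products because of commutativity ([block_mul]).  Conversely,
every pair [x], [y] of related elements must lie in some [C]; the
subsemilattice [{x, y, xy}] works, since multiplying [x tau y] by [x tau x]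
and by [y tau y] relates [xy] to [x] and to [y] ([block_pair]). *)

(** Compatibility and homomorphisms quantify over operation symbols and argument
tuples; this reduces both to conditions on the single product [mul]. *)
Lemma interp_mul (A : algebra binary_signature) (f : symbol binary_signature)
    (a : (arity f).-tuple A) :
  interp a = mul (tnth (a : 2.-tuple A) ord0) (tnth (a : 2.-tuple A) ord_max).
Proof.
case: f a => a; rewrite /mul; congr (interp _).
apply: eq_from_tnth => -[[|[|]]] //= lti;
  by rewrite [RHS](tnth_nth (tnth (a : 2.-tuple A) ord0)) /=; congr tnth;
     apply: val_inj.
Qed.

Lemma compatible_mul (A : algebra binary_signature) (r : A -> A -> Prop) :
  compatible r <->
  forall a b c d, r a b -> r c d -> r (mul a c) (mul b d).
Proof.
split=> [rM a b c d rab rcd | rM f a b rab]; last first.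
  by rewrite !interp_mul; apply: rM; apply: rab.
by apply: rM => -[[|[|]]].
Qed.

Lemma homomorphism_mul (B A : algebra binary_signature) (phi : B -> A) :
  {morph phi : x y / mul x y} -> homomorphism phi.
Proof. by move=> phiM f b; rewrite !interp_mul phiM !tnth_map. Qed.

Definition binary_algebra (T : Type) (op : T -> T -> T) :
    algebra binary_signature :=
  @Algebra binary_signature T
    (fun _ (t : 2.-tuple T) => op (tnth t ord0) (tnth t ord_max)).

Section SetMul.
Variable A : algebra binary_signature.
Implicit Types C D : set A.

Definition set_mul C D : set A := [set mul x y | x in C & y in D].

Lemma set_mulS C C' D D' :
  C `<=` C' -> D `<=` D' -> set_mul C D `<=` set_mul C' D'.
Proof.
by move=> CC' DD' _ [x /CC' C'x [y /DD' D'y <-]]; exists x => //; exists y.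
Qed.

Hypothesis mulA : associative (@mul A).
Hypothesis mulC : commutative (@mul A).
Hypothesis mulxx : idempotent_op (@mul A).

Lemma set_mulA : associative set_mul.
Proof.
move=> C D E; apply/seteqP; split.
  move=> _ [x Cx [_ [y Dy [z Ez <-]] <-]]; rewrite mulA.
  by exists (mul x y); [exists x => //; exists y | exists z].
move=> _ [_ [x Cx [y Dy <-]] [z Ez <-]]; rewrite -mulA.
by exists x => //; exists (mul y z) => //; exists y => //; exists z.
Qed.

Lemma set_mulC : commutative set_mul.
Proof.
move=> C D; apply/seteqP; split=> _ [x Cx [y Dy <-]]; rewrite mulC;
by exists y => //; exists x.
Qed.

Lemma set_mulxx C : set_mul C C `<=` C -> set_mul C C = C.
Proof.
by move=> CC; apply/seteqP; split=> // x Cx; exists x => //; exists x.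
Qed.

Variable tau : A -> A -> Prop.
Hypothesis tau_tol : tolerance tau.

Definition block C : Prop :=
  set_mul C C `<=` C /\ (forall x y, C x -> C y -> tau x y).

Let tauM a b c d : tau a b -> tau c d -> tau (mul a c) (mul b d).
Proof. by have [_ _ /compatible_mul] := tau_tol; apply. Qed.

(** The product of two subsemilattices is again one because the factors of
[(cd)(c'd')] can be regrouped as [(cc')(dd')]; compatibility of [tau] keeps its
elements related. *)
Lemma block_mul C D : block C -> block D -> block (set_mul C D).
Proof.
move=> [CC tauC] [DD tauD]; split.
  rewrite set_mulA -(set_mulA C) (set_mulC D) set_mulA -set_mulA.
  exact: set_mulS.
move=> _ _ [x Cx [y Dy <-]] [z Cz [t Dt <-]].
by apply: tauM; [apply: tauC | apply: tauD].
Qed.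

(** This is where [tau] is seen to be covered by its blocks, so that nothing is
lost when pairs of related elements are lifted to pointed blocks. *)
Lemma block_pair x y :
  tau x y -> block [set z | [\/ z = x, z = y | z = mul x y]].
Proof.
have [tauxx tauC _] := tau_tol => txy.
have tx : tau x (mul x y) by rewrite -{1}(mulxx x); apply: tauM.
have ty : tau y (mul x y).
  by rewrite -{1}(mulxx y); apply: tauM => //; apply: tauC.
have xxy : mul x (mul x y) = mul x y by rewrite mulA mulxx.
have yxy : mul y (mul x y) = mul x y by rewrite mulC -mulA mulxx.
split=> [_ [z zP [t tP <-]] | z t]; last first.
  by case=> ->; case=> ->; by [apply: tauxx | | apply: tauC].
case: zP => ->; case: tP => -> /=; rewrite ?mulxx ?xxy ?yxy;
  by [apply: Or31 | apply: Or32 | apply: Or33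
     | apply: Or33; rewrite mulC ?xxy ?yxy].
Qed.

Definition pointed_block : Type :=
  {p : set A * A | block p.1 /\ p.1 p.2}.

Lemma pointed_block_mul_subproof (p q : pointed_block) :
  let r := (set_mul (sval p).1 (sval q).1, mul (sval p).2 (sval q).2) in
  block r.1 /\ r.1 r.2.
Proof.
case: p q => -[C a] /= [Cblock Ca] [[D b] /= [Dblock Db]].
by split; [apply: block_mul | exists a => //; exists b].
Qed.

Definition pointed_block_mul p q : pointed_block :=
  exist _ _ (pointed_block_mul_subproof p q).

Definition pointed_block_algebra := binary_algebra pointed_block_mul.

Lemma pointed_block_inj (p q : pointed_block) : sval p = sval q -> p = q.
Proof. by case: p q => p pP [q qP] /= pq; apply: eq_exist. Qed.

Lemma pointed_block_semilattice : semilattices pointed_block_algebra.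
Proof.
apply/semilatticesP; split=> [p q r | p q | p]; apply: pointed_block_inj => /=.
- by congr pair; [apply: set_mulA | apply: mulA].
- by congr pair; [apply: set_mulC | apply: mulC].
case: p => -[C a] /= [[CC _] _].
by congr pair; [apply: set_mulxx | apply: mulxx].
Qed.

Definition same_block (p q : pointed_block_algebra) : Prop :=
  (sval p).1 = (sval q).1.

Lemma same_block_congruence : congruence same_block.
Proof.
split; first by split=> // p q r; rewrite /same_block => ->.
by apply/compatible_mul => p q r s pq rs; congr set_mul.
Qed.

Definition point (p : pointed_block_algebra) : A := (sval p).2.

Lemma point_homomorphism : homomorphism point.
Proof. exact: homomorphism_mul. Qed.

Lemma rel_image_same_block x y : tau x y <-> rel_image point same_block x y.
Proof.
split=> [txy | [p [q [pq -> ->]]]]; last first.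
  case: (svalP p) => -[_ tauC] Cp; apply: tauC => //.
  by rewrite (pq : (sval p).1 = (sval q).1); case: (svalP q).
set C := [set z | [\/ z = x, z = y | z = mul x y]].
have Cblock : block C := block_pair txy.
have Cx : block C /\ C x by split=> //; apply: Or31.
have Cy : block C /\ C y by split=> //; apply: Or32.
by exists (exist _ (C, x) Cx), (exist _ (C, y) Cy).
Qed.

End SetMul.

Theorem corollary4p2 : TImC semilattices.
Proof.
move=> A /semilatticesP[mulA mulC mulxx] tau tau_tol.
exists (pointed_block_algebra mulA mulC tau_tol).
exists (@same_block A mulA mulC tau tau_tol), (@point A mulA mulC tau tau_tol).
split.
- exact: pointed_block_semilattice.
- exact: same_block_congruence.
- exact: point_homomorphism.
- exact: rel_image_same_block.
Qed.
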